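(* Let $D=1$ and, for $d\in[0,1]$, $\varepsilon\in\mathbb R$, let $$\widehat W(d,\varepsilon)=\inf_{\substack{\tilde d\in BV(\Omega;\{0,1\})\\ \langle\tilde d\rangle=d}}\ \inf_{\tilde u|_{\partial\Omega}=\varepsilon x}\ \frac1{|\Omega|}\int_\Omega\tilde d\,W_1(\tilde u')+(1-\tilde d)\,W_2(\tilde u')\,dx .$$ Then, with $d_1=d$, $d_2=1-d$, $$\widehat W(d,\varepsilon)=d\,W_1(\varepsilon_1^* )+(1-d)\,W_2(\varepsilon_2^* ),$$ where $$\varepsilon_1^*(d,\varepsilon)=\frac{\alpha_2(\varepsilon-d_2\varepsilon_2^T)+d_2\alpha_1\varepsilon_1^T}{d_2\alpha_1+d_1\alpha_2},\qquad \varepsilon_2^*(d,\varepsilon)=\frac{\alpha_1(\varepsilon-d_1\varepsilon_1^T)+d_1\alpha_2\varepsilon_2^T}{d_2\alpha_1+d_1\alpha_2}.$$ The partial derivatives of $\widehat W$ are given by $$\frac{\partial\widehat W}{\partial\varepsilon}(d,\varepsilon)=\frac{\alpha_1\alpha_2\big[d_1(\varepsilon-\varepsilon_1^T)+d_2(\varepsilon-\varepsilon_2^T)\big]}{d_2\alpha_1+d_1\alpha_2},$$ $$\frac{\partial\widehat W}{\partial d}(d,\varepsilon)=W_1(\varepsilon_1^* )-W_2(\varepsilon_2^* )+\frac{\alpha_1\alpha_2}{(d_2\alpha_1+d_1\alpha_2)^2}\Big[(\alpha_1-\alpha_2)\varepsilon^2+d_1\alpha_1(\varepsilon_1^T)^2-d_2\alpha_2(\varepsilon_2^T)^2$$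 $$\qquad+\big(\alpha_2\varepsilon_2^T-\alpha_1\varepsilon_1^T+(\alpha_2-\alpha_1)(d_1\varepsilon_1^T+d_2\varepsilon_2^T)\big)\varepsilon+(d_2\alpha_1-d_1\alpha_2)\varepsilon_1^T\varepsilon_2^T\Big].$$
   Context: $\Omega\subset\mathbb R$ is a bounded domain (open interval). For $i=1,2$, $W_i(\varepsilon)=\frac12\alpha_i(\varepsilon-\varepsilon_i^T)^2+w_i$ with constants $\alpha_i>0$ (elastic moduli), $\varepsilon_i^T\in\mathbb R$ (eigenstrains; the superscript $T$ is a label), $w_i\ge0$. $\langle\tilde d\rangle=\frac1{|\Omega|}\int_\Omega\tilde d\,dx$. The inner infimum is over $\tilde u\in H^1(\Omega)$ with $\tilde u(x)=\varepsilon x$ for $x\in\partial\Omega$. *)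

(* Defs.v *)
From HB Require Import structures.
From mathcomp Require Import all_boot all_order all_algebra.
From mathcomp Require Import all_classical all_reals all_analysis.

Set Implicit Arguments.
Unset Strict Implicit.
Unset Printing Implicit Defensive.
Import Order.TTheory GRing.Theory Num.Theory.
Import numFieldNormedType.Exports.

Local Open Scope classical_set_scope.
Local Open Scope ring_scope.

Section function_spaces.
Context {R : realType}.
Let mu := @lebesgue_measure R.
Implicit Types (Om : set R) (u v phi : R -> R).

(* C^1_c(Om); functions on Om are identified with their extension by 0. *)
Definition test_fun Om phi : Prop :=
  [/\ forall x : R, derivable phi x 1,
      continuous (derive1 phi),
      compact (closure [set x | phi x != 0]) &
      closure [set x | phi x != 0] `<=` Om].

Definition L2 Om u : Prop :=
  measurable_fun Om u /\ mu.-integrable Om (fun x => (u x ^+ 2)%:E).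

Definition weak_derivative Om u v : Prop :=
  forall phi, test_fun Om phi ->
    (\int[mu]_(x in Om) (u x * derive1 phi x)%:E =
     - \int[mu]_(x in Om) (v x * phi x)%:E)%E.

(* u is in H^1(Om) and v is a representative of its weak derivative u'
   (which is unique only almost everywhere). *)
Definition H1_with_derivative Om u v : Prop :=
  [/\ L2 Om u, L2 Om v & weak_derivative Om u v].

(* Boundary values of the class of u, read on the representative that is
   continuous up to the boundary; every H^1 function on a bounded interval has
   exactly one. *)
Definition has_boundary_values (a b : R) u (ua ub : R) : Prop :=
  exists U : R -> R,
    [/\ {within `[a, b], continuous U},
        {ae mu, forall x, x \in `]a, b[ -> u x = U x},
        U a = ua & U b = ub].

Definition distr_variation Om u : \bar R :=
  ereal_sup [set (\int[mu]_(x in Om) (u x * derive1 phi x)%:E)%E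
            | phi in [set phi | test_fun Om phi /\ forall x, `|phi x| <= 1]].

Definition BV Om u : Prop :=
  mu.-integrable Om (EFin \o u) /\ (distr_variation Om u < +oo)%E.

Definition BV01 Om u : Prop :=
  BV Om u /\ forall x, Om x -> u x = 0 \/ u x = 1.

Definition average Om u : \bar R :=
  ((mu Om)^-1 * \int[mu]_(x in Om) (u x)%:E)%E.

End function_spaces.

Section relaxed_energy.
Context {R : realType}.

Definition elastic_energy (alpha epsT w eps : R) : R :=
  2^-1 * alpha * (eps - epsT) ^+ 2 + w.

(* On Om = ]a, b[; v stands for the weak derivative of the displacement u. *)
Definition min_energy (a b : R) (W1 W2 dt : R -> R) (eps : R) : \bar R :=
  ereal_inf [set y | exists u v : R -> R,
    [/\ H1_with_derivative `]a, b[ u v,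
        has_boundary_values a b u (eps * a) (eps * b) &
        y = average `]a, b[
              (fun x => dt x * W1 (v x) + (1 - dt x) * W2 (v x))]].

Definition What (a b : R) (W1 W2 : R -> R) (d eps : R) : \bar R :=
  ereal_inf [set min_energy a b W1 W2 dt eps
            | dt in [set dt | BV01 `]a, b[ dt /\ average `]a, b[ dt = d%:E]].

Definition eps1_star (alpha1 alpha2 eps1T eps2T d eps : R) : R :=
  let d1 := d in let d2 := 1 - d in
  (alpha2 * (eps - d2 * eps2T) + d2 * alpha1 * eps1T) /
  (d2 * alpha1 + d1 * alpha2).

Definition eps2_star (alpha1 alpha2 eps1T eps2T d eps : R) : R :=
  let d1 := d in let d2 := 1 - d in
  (alpha1 * (eps - d1 * eps1T) + d1 * alpha2 * eps2T) /
  (d2 * alpha1 + d1 * alpha2).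

(* l is the derivative at x of f restricted to A: the ordinary derivative when
   x is interior to A, the one-sided one at an endpoint of an interval. *)
Definition is_derive_within (A : set R) (f : R -> R) (x l : R) : Prop :=
  (f t - f x) / (t - x) @[t --> within A x^'] --> l.

End relaxed_energy.

(* Main.v *)
(* The energy densities are convex and [eps1_star], [eps2_star] are the strains
   with equal stress [sigma = W1' e1 = W2' e2] and average [eps].  Bounding each
   density from below by its tangent of slope [sigma] turns the energy of any
   competitor into an affine functional of [u'], whose average is [eps] by the
   boundary condition; this gives the lower bound, whatever the arrangement of
   the phases.  It is attained by the single-interface laminate: phase 1 on
   [a < x < a + d (b - a)], phase 2 on the rest, [u] piecewise affine.

   That the mean of the weak derivative is the increment of the boundary values
   is obtained by testing with C^1 trapezoids that increase to 1 on ]a, b[. *)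
Require Import Defs.
From HB Require Import structures.
From mathcomp Require Import all_boot all_order all_algebra.
From mathcomp Require Import all_classical all_reals all_analysis.
From mathcomp Require Import measurable_realfun.
From mathcomp Require Import ring lra.
Set Implicit Arguments.
Unset Strict Implicit.
Unset Printing Implicit Defensive.
Import Order.TTheory GRing.Theory Num.Theory.
Import numFieldNormedType.Exports.
Local Open Scope classical_set_scope.
Local Open Scope ring_scope.

Local Notation mu := lebesgue_measure.

(** * Integrability on bounded open intervals *)

Lemma lebesgue_measure_itvoo_lt (R : realType) (a b : R) :
  (mu (`]a, b[ : set R) < +oo)%E.
Proof. by rewrite lebesgue_measure_itv /=; case: ifP => _; rewrite ltry. Qed.

Lemma continuous_bounded_itvoo (R : realType) (f : R -> R) (a b : R) :
  continuous f -> [bounded f x | x in `]a, b[].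
Proof.
move=> cf.
have : bounded_set (f @` `[a, b]).
  apply/compact_bounded/continuous_compact; last exact: segment_compact.
  exact/continuous_subspaceT.
move=> [M [Mr HM]]; exists M; split=> // x Mx y /= yab.
by apply: (HM _ Mx); exists y => //; apply: subset_itv_oo_cc.
Qed.

Lemma bounded_integrable_itvoo (R : realType) (f : R -> R) (a b : R) :
  measurable_fun setT f -> [bounded f x | x in `]a, b[] ->
  mu.-integrable `]a, b[ (EFin \o f).
Proof.
move=> mf bf; apply: measurable_bounded_integrable => //.
- exact: lebesgue_measure_itvoo_lt.
- exact: measurable_funTS.
Qed.

Lemma continuous_affine (R : realType) (p q : R) :
  continuous (fun x : R => p + q * x).
Proof.
by move=> x; apply: cvgD; [exact: cvg_cst | apply: cvgMr; exact: cvg_id].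
Qed.

Lemma continuous_integrable_itvoo (R : realType) (a b : R) (f : R -> R) :
  continuous f -> mu.-integrable `]a, b[ (EFin \o f).
Proof.
move=> cf; apply: bounded_integrable_itvoo (continuous_bounded_itvoo _ _ cf).
exact: continuous_measurable_fun.
Qed.

Lemma integrable_continuousM (R : realType) (u phi : R -> R) (a b : R) :
  mu.-integrable `]a, b[ (EFin \o u) -> continuous phi ->
  mu.-integrable `]a, b[ (fun x => (u x * phi x)%:E).
Proof.
move=> iu cphi; apply: (integrableMl _ iu) => //.
  by apply: measurable_funTS; exact: continuous_measurable_fun.
exact: continuous_bounded_itvoo.
Qed.

(** On a bounded interval [1 + u ^+ 2] is integrable, and it dominates the absolute value of [u]. *)
Lemma L2_integrable (R : realType) (u : R -> R) (a b : R) :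
  L2 `]a, b[ u -> mu.-integrable `]a, b[ (EFin \o u).
Proof.
move=> [mu_u iu2].
have i1 : mu.-integrable `]a, b[ (EFin \o (fun x : R => 1 : R)).
  by apply: continuous_integrable_itvoo => x; exact: cvg_cst.
apply: (le_integrable _ _ _ (integrableD _ i1 iu2)) => //.
  exact/measurable_EFinP.
move=> x _ /=; rewrite lee_fin; apply: le_trans (ler_norm _).
by case: (ler0P (u x)) => ux; nra.
Qed.

(** * Integration by parts against affine functions *)

(** The degenerate case [a = b] is included because the interface of the laminate sits at an
    endpoint when [d] is 0 or 1. *)
Lemma integral_derive1 (R : realType) (F : R -> R) (a b : R) :
  a <= b -> (forall x : R, derivable F x 1) -> continuous (derive1 F) ->
  (\int[mu]_(x in `]a, b[) (derive1 F x)%:E = (F b - F a)%:E)%E.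
Proof.
rewrite le_eqVlt => /orP[/eqP -> | ab] dF cF'.
  by rewrite set_itv_ge ?bnd_simp ?ltxx// integral_set0 subrr.
have cF : continuous F.
  by move=> x; apply: differentiable_continuous; exact/derivable1_diffP.
(* The endpoints form a null set; adding them gives the closed interval of the fundamental
   theorem. *)
rewrite -(@integral_itv_bndoo _ _ _ _ true false); last first.
  by apply/measurable_EFinP/measurable_funTS; exact: continuous_measurable_fun.
rewrite EFinB; apply: (@continuous_FTC2 _ (derive1 F) F a b ab).
- exact: continuous_subspaceT.
- split=> [x _ | |]; first exact: dF.
    exact/cvg_at_right_filter/cF.
  exact/cvg_at_left_filter/cF.
- by move=> x _.
Qed.

(** The fundamental theorem applied to the product [F]. The boundary terms are kept: on one side of
    an interface, a test function need not vanish at the interface. *)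
Lemma integral_affine_derive1 (R : realType) (phi : R -> R) (a b p q : R) :
  a <= b -> (forall x : R, derivable phi x 1) -> continuous (derive1 phi) ->
  (\int[mu]_(x in `]a, b[) ((p + q * x) * derive1 phi x)%:E =
   ((p + q * b) * phi b - (p + q * a) * phi a)%:E -
   \int[mu]_(x in `]a, b[) (q * phi x)%:E)%E.
Proof.
move=> ab dphi cphi'.
pose F x : R := (p + q * x) * phi x.
have cphi : continuous phi.
  by move=> x; apply: differentiable_continuous; exact/derivable1_diffP.
have dF (x : R) : is_derive x (1 : R) F ((p + q * x) * derive1 phi x + q * phi x).
  have dphix : is_derive x (1 : R) phi (derive1 phi x).
    by rewrite derive1E; apply: DeriveDef.
  by apply: is_derive_eq; rewrite /GRing.scale /=; ring.
have F'E : derive1 F = fun x => (p + q * x) * derive1 phi x + q * phi x.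
  by apply/funext => x; rewrite derive1E derive_val.
have c1 : continuous (fun x => (p + q * x) * derive1 phi x).
  by move=> x; apply: cvgM; [exact: continuous_affine | exact: cphi'].
have c2 : continuous (fun x => q * phi x).
  by move=> x; apply: cvgM; [exact: cvg_cst | exact: cphi].
have cF' : continuous (derive1 F).
  by rewrite F'E => x; apply: cvgD; [exact: c1 | exact: c2].
have := integral_derive1 ab (fun x => @ex_derive _ _ _ _ _ _ _ (dF x)) cF'.
rewrite F'E.
under eq_integral do rewrite EFinD.
rewrite integralD_EFin//; last 2 first.
- exact: (continuous_integrable_itvoo a b c1).
- exact: (continuous_integrable_itvoo a b c2).
move=> <-; rewrite addeK//.
by apply: integrable_fin_num => //; exact: (continuous_integrable_itvoo a b c2).
Qed.

(** * Functions glued at one point *)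

(** One combinator describes the phase indicator, displacement, strain and energy density of the
    laminate, so their integrals all split in the same way. *)
Definition piecewise (T : Type) (R : realType) (c : R) (f g : R -> T) : R -> T :=
  fun x => if x < c then f x else g x.

Lemma measurable_piecewise (R : realType) (c : R) (f g : R -> R) :
  measurable_fun setT f -> measurable_fun setT g ->
  measurable_fun setT (piecewise c f g).
Proof.
move=> mf mg; apply: measurable_fun_ifT => //.
exact: measurable_fun_ltr.
Qed.

Lemma integral_piecewise (R : realType) (a b c : R) (f g : R -> R) :
  a <= c <= b -> measurable_fun setT f -> measurable_fun setT g ->
  (\int[mu]_(x in `]a, b[) (piecewise c f g x)%:E =
   \int[mu]_(x in `]a, c[) (f x)%:E + \int[mu]_(x in `]c, b[) (g x)%:E)%E.
Proof.
move=> /andP[ac cb] mf mg.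
have mE (D : set R) h : measurable_fun setT h ->
    measurable_fun D (fun x => (h x)%:E).
  by move=> mh; apply/measurable_EFinP; exact: measurable_funTS.
have mp := measurable_piecewise c mf mg.
(* Left-closed, right-open intervals partition exactly at [c], and put [c] on the side of [g] as
   [piecewise] does. *)
rewrite -(@integral_itv_bndoo _ _ _ _ true true); last exact: mE.
have -> : `[a, b[%classic = `[a, c[%classic `|` `[c, b[%classic :> set R.
  by rewrite -itv_bndbnd_setU ?bnd_simp.
rewrite integral_setU //; last 2 first.
- exact: mE.
- by apply/disj_setPS => x [] /=; rewrite !in_itv/= => /andP[_ xc] /andP[cx _]; lra.
rewrite -[in RHS](@integral_itv_bndoo _ a c _ true true); last exact: mE.
rewrite -[in RHS](@integral_itv_bndoo _ c b _ true true); last exact: mE.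
congr (_ + _)%E; apply: eq_integral => x; rewrite inE/= in_itv/= /piecewise.
  by move=> /andP[_ ->].
by move=> /andP[cx _]; rewrite ltNge cx.
Qed.

Lemma test_fun_out (R : realType) (Om : set R) (phi : R -> R) (x : R) :
  test_fun Om phi -> ~ Om x -> phi x = 0.
Proof.
move=> [_ _ _ sub] xOm; apply/eqP/negPn/negP => phix.
by apply: xOm; apply/sub/subset_closure.
Qed.

Lemma piecewise_bounded (R : realType) (D : set R) (c : R) (f g : R -> R) :
  [bounded f x | x in D] -> [bounded g x | x in D] ->
  [bounded piecewise c f g x | x in D].
Proof.
move=> [M [Mr fM]] [N [Nr gN]].
exists (Num.max M N); split=> [|K]; first exact: num_real.
rewrite gt_max => /andP[MK NK] x Dx; rewrite /= /piecewise.
by case: ifP => _; [exact: fM | exact: gN].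
Qed.

Lemma integrable_piecewise (R : realType) (a b c : R) (f g : R -> R) :
  continuous f -> continuous g ->
  mu.-integrable `]a, b[ (EFin \o piecewise c f g).
Proof.
move=> cf cg; apply: bounded_integrable_itvoo.
  by apply: measurable_piecewise; exact: continuous_measurable_fun.
by apply: piecewise_bounded; exact: continuous_bounded_itvoo.
Qed.

Lemma L2_piecewise (R : realType) (a b c : R) (f g : R -> R) :
  continuous f -> continuous g -> L2 `]a, b[ (piecewise c f g).
Proof.
move=> cf cg; split.
  by apply: measurable_funTS; apply: measurable_piecewise;
    exact: continuous_measurable_fun.
have := @integrable_piecewise R a b c (fun x => f x * f x) (fun x => g x * g x).
rewrite (_ : EFin \o _ = fun x => (piecewise c f g x ^+ 2)%:E); last first.
  by apply/funext => x /=; rewrite /piecewise expr2; case: ifP.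
by apply=> x; apply: cvgM; (exact: cf || exact: cg).
Qed.

Lemma test_fun_continuous (R : realType) (Om : set R) (phi : R -> R) :
  test_fun Om phi -> continuous phi.
Proof.
move=> [dphi _ _ _] x; apply: differentiable_continuous.
exact/derivable1_diffP.
Qed.

(** Integrate by parts on each side of [c]: the boundary terms at [a] and [b] vanish with [phi], and
    those at [c] cancel because the two affine pieces agree there. *)
Lemma weak_derivative_piecewise_affine (R : realType) (a b c p q p' q' : R) :
  a <= c <= b -> p + q * c = p' + q' * c ->
  weak_derivative `]a, b[
    (piecewise c (fun x => p + q * x) (fun x => p' + q' * x))
    (piecewise c (cst q) (cst q')).
Proof.
move=> /andP[ac cb] pq phi tphi.
have cphi := test_fun_continuous tphi.
have phia : phi a = 0.
  by apply: test_fun_out tphi _ => /=; rewrite in_itv/= ltxx.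
have phib : phi b = 0.
  by apply: test_fun_out tphi _ => /=; rewrite in_itv/= ltxx andbF.
have [dphi cphi' _ _] := tphi.
have cM (r s : R) : continuous (fun x => (r + s * x) * derive1 phi x).
  by move=> x; apply: cvgM; [exact: continuous_affine | exact: cphi'].
have cZ (r : R) : continuous (fun x => r * phi x).
  by move=> x; apply: cvgM; [exact: cvg_cst | exact: cphi].
under eq_integral => x _.
  rewrite (_ : _ * _ = piecewise c (fun x => (p + q * x) * derive1 phi x)
    (fun x => (p' + q' * x) * derive1 phi x) x).
  over.
  by rewrite /piecewise; case: ifP.
under [in RHS]eq_integral => x _.
  rewrite (_ : _ * _ = piecewise c (fun x => q * phi x) (fun x => q' * phi x) x).
  over.
  by rewrite /piecewise; case: ifP.
rewrite !integral_piecewise ?ac ?cb//; do ?exact: continuous_measurable_fun.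
rewrite !integral_affine_derive1//.
(* Finiteness turns the identity between extended reals into one in [R], where [ring] applies. *)
have fin (r s t : R) : (\int[mu]_(x in `]s, t[) (r * phi x)%:E)%E \is a fin_num.
  apply: integrable_fin_num => //.
  exact: (continuous_integrable_itvoo s t (cZ r)).
rewrite -(fineK (fin q a c)) -(fineK (fin q' c b)) -?(EFinB, EFinD, EFinN).
by rewrite phia phib pq; congr (_%:E); ring.
Qed.

Lemma lebesgue_measure_itvoo (R : realType) (a b : R) :
  a <= b -> mu (`]a, b[ : set R) = (b - a)%:E.
Proof.
rewrite lebesgue_measure_itv /= lte_fin le_eqVlt => /orP[/eqP -> | ->] //.
by rewrite ltxx subrr.
Qed.

Lemma integral_cst_itvoo (R : realType) (a b r : R) :
  a <= b -> (\int[mu]_(x in `]a, b[) (cst r x)%:E = (r * (b - a))%:E)%E.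
Proof.
move=> ab; rewrite EFinM -lebesgue_measure_itvoo//.
by rewrite -(integral_cst mu).
Qed.

Lemma average_piecewise_cst (R : realType) (a b c p q : R) :
  a < b -> a <= c <= b ->
  average `]a, b[ (piecewise c (cst p) (cst q)) =
  ((p * (c - a) + q * (b - c)) / (b - a))%:E.
Proof.
move=> ab acb; have /andP[ac cb] := acb.
rewrite /average integral_piecewise//.
rewrite !integral_cst_itvoo// lebesgue_measure_itvoo ?(ltW ab)//.
rewrite inver ifF; last by apply/negbTE; lra.
by rewrite -!EFinM mulrC.
Qed.

(** A single jump has variation at most 1: pairing the indicator with the derivative of [phi] leaves
    [phi c - phi a = phi c]. *)
Lemma BV01_piecewise (R : realType) (a b c : R) :
  a <= c <= b -> BV01 `]a, b[ (piecewise c (cst 1) (cst 0)).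
Proof.
move=> acb; have /andP[ac cb] := acb; split; last first.
  by move=> x _; rewrite /piecewise; case: ifP => _; [right | left].
split.
  by apply: integrable_piecewise => x; exact: cvg_cst.
apply: (@le_lt_trans _ _ 1%:E); last exact: ltry.
apply: ge_ereal_sup => _ [phi [tphi phi1] <-].
have [dphi cphi' _ _] := tphi.
have phia : phi a = 0.
  by apply: test_fun_out tphi _ => /=; rewrite in_itv/= ltxx.
under eq_integral => x _.
  rewrite (_ : _ * _ = piecewise c (derive1 phi) (cst 0) x).
  over.
  by rewrite /piecewise; case: ifP => _; rewrite ?mul1r ?mul0r.
rewrite integral_piecewise//; last exact: continuous_measurable_fun.
rewrite integral0 adde0 integral_derive1// phia subr0 lee_fin.
exact: le_trans (ler_norm _) (phi1 c).
Qed.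

Lemma has_boundary_values_piecewise_affine (R : realType)
    (a b c p q p' q' : R) :
  a <= c <= b -> p + q * c = p' + q' * c ->
  has_boundary_values a b
    (piecewise c (fun x => p + q * x) (fun x => p' + q' * x))
    (p + q * a) (p' + q' * b).
Proof.
move=> /andP[ac cb] pq.
(* A single continuous formula for the glued function: left of [c] the correction changes the slope
   from [q'] to [q], and [pq] matches the intercepts. *)
exists (fun x => p' + q' * x + (q - q') * Num.min (x - c) 0); split.
- apply: continuous_subspaceT => x; apply: cvgD.
    exact: continuous_affine.
  apply: cvgM; first exact: cvg_cst.
  apply: (@continuous_min R R (fun x => x - c) (cst 0)); last exact: cvg_cst.
  by apply: cvgB; [exact: cvg_id | exact: cvg_cst].
- apply: aeW => x _; rewrite /piecewise; case: ifPn => xc.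
    by rewrite min_l; [nra | lra].
  by rewrite min_r ?mulr0 ?addr0//; lra.
- by rewrite min_l; [nra | lra].
- by rewrite min_r ?mulr0 ?addr0//; lra.
Qed.

(** * C^1 trapezoidal test functions *)

(** A criterion that treats all points alike, so that squared positive parts are differentiated at
    their kink as anywhere else. *)
Lemma is_derive_quadratic_error (R : realType) (f : R -> R) (x l : R) :
  (forall y, `|f y - f x - l * (y - x)| <= (y - x) ^+ 2) ->
  is_derive x (1 : R) f l.
Proof.
move=> fl.
have cvgl : (fun h : R => h^-1 *: ((f \o shift x) (h *: (1 : R)) - f x)) @ 0^'
    --> l.
  apply/cvgrPdist_le => e e0; near=> h.
  have h0 : h != 0 by near: h; exact: nbhs_dnbhs_neq.
  have := fl (h *: (1 : R) + x).
  rewrite /= /GRing.scale/= mulr1 addrK -real_normK ?num_real// => flh.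
  rewrite distrC -[X in _ - X](mulKf h0) -mulrBr normrM normfV [h * l]mulrC.
  rewrite ler_pdivrMl ?normr_gt0//; apply: le_trans flh _.
  rewrite expr2 ler_wpM2l//.
  by near: h; apply: dnbhs0_le.
by apply: DeriveDef; [apply/cvg_ex; exists l | exact/cvg_lim].
Unshelve. all: by end_near. Qed.

Definition pos_part (R : realType) (x : R) : R := Num.max x 0.

Lemma pos_part_ge (R : realType) (x : R) : 0 <= x -> pos_part x = x.
Proof. exact: max_l. Qed.

Lemma pos_part_le (R : realType) (x : R) : x <= 0 -> pos_part x = 0.
Proof. exact: max_r. Qed.

Lemma continuous_pos_part (R : realType) : continuous (@pos_part R).
Proof.
move=> x; apply: (@continuous_max R R (fun x => x) (cst 0)).
  exact: cvg_id.
exact: cvg_cst.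
Qed.

(** If [x] and [y] have the same sign, the error is [(y - x) ^+ 2] or 0; otherwise it is
    [x ^+ 2 - 2 * x * y] or [y ^+ 2], and [x * y <= 0] gives the bound. *)
Lemma sqr_pos_part_error (R : realType) (x y : R) :
  `|pos_part y ^+ 2 - pos_part x ^+ 2 - 2 * pos_part x * (y - x)|
    <= (y - x) ^+ 2.
Proof.
have pE (z : R) : 0 <= z /\ pos_part z = z \/ z <= 0 /\ pos_part z = 0.
  have [z0|/ltW z0] := lerP 0 z; [left | right]; split=> //.
    exact: pos_part_ge.
  exact: pos_part_le.
have xy := sqr_ge0 (y - x); have y2 := sqr_ge0 y; have x2 := sqr_ge0 x.
rewrite ler_norml.
case: (pE x) => -[x0 ->]; case: (pE y) => -[y0 ->].
- lra.
- have := mulr_ge0_le0 x0 y0; lra.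
- have := mulr_le0_ge0 x0 y0; lra.
- lra.
Qed.

Lemma is_derive_sqr_pos_partDr (R : realType) (c x : R) :
  is_derive x (1 : R) (fun y => pos_part (y - c) ^+ 2) (2 * pos_part (x - c)).
Proof.
apply: is_derive_quadratic_error => y.
by have := sqr_pos_part_error (x - c) (y - c); rewrite opprB addrA addrNK.
Qed.

Lemma is_derive_sqr_pos_partBr (R : realType) (c x : R) :
  is_derive x (1 : R) (fun y => pos_part (c - y) ^+ 2) (- 2 * pos_part (c - x)).
Proof.
apply: is_derive_quadratic_error => y.
have := sqr_pos_part_error (c - x) (c - y).
rewrite (_ : c - y - (c - x) = - (y - x)); last by ring.
by rewrite sqrrN mulrN !mulNr.
Qed.

(** The C^1 quadratic spline with knots 0, [h], [2 * h] rising from 0 to 1. Written with positive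
    parts, it can be differentiated term by term. *)
Definition ramp (R : realType) (h t : R) : R :=
  (2 * h ^+ 2)^-1 *
  (pos_part t ^+ 2 - 2 * pos_part (t - h) ^+ 2 + pos_part (t - 2 * h) ^+ 2).

(** The derivative of [ramp h]: the tent on [[0, 2 * h]] with peak [1 / h] at [h]. *)
Definition hat (R : realType) (h t : R) : R :=
  (h ^+ 2)^-1 * (pos_part t - 2 * pos_part (t - h) + pos_part (t - 2 * h)).

Lemma ramp_le0 (R : realType) (h t : R) : 0 < h -> t <= 0 -> ramp h t = 0.
Proof.
by move=> h0 t0; rewrite /ramp !pos_part_le; [ring | lra..].
Qed.

Lemma hat_le0 (R : realType) (h t : R) : 0 < h -> t <= 0 -> hat h t = 0.
Proof.
by move=> h0 t0; rewrite /hat !pos_part_le; [ring | lra..].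
Qed.

Lemma ramp_ge (R : realType) (h t : R) : 0 < h -> 2 * h <= t -> ramp h t = 1.
Proof.
move=> h0 t0; rewrite /ramp !pos_part_ge; try lra.
by field; rewrite ?gt_eqF; lra.
Qed.

Lemma hat_ge (R : realType) (h t : R) : 0 < h -> 2 * h <= t -> hat h t = 0.
Proof.
by move=> h0 t0; rewrite /hat !pos_part_ge; lra.
Qed.

Lemma ramp_itv (R : realType) (h t : R) : 0 < h -> 0 <= ramp h t <= 1.
Proof.
move=> h0; have [t0|t0] := lerP t 0; first by rewrite ramp_le0// lexx ler01.
have [ht|th] := lerP (2 * h) t; first by rewrite ramp_ge// lexx ler01.
have h2 : 0 < 2 * h ^+ 2 by rewrite mulr_gt0// exprn_gt0.
rewrite /ramp (pos_part_ge (ltW t0)) (@pos_part_le _ (t - 2 * h)); last by lra.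
rewrite mulrC ler_pdivlMr// ler_pdivrMr//.
have [th'|ht'] := lerP t h.
  by rewrite (@pos_part_le _ (t - h)); [apply/andP; split; nra | lra].
by rewrite (@pos_part_ge _ (t - h)); [apply/andP; split; nra | lra].
Qed.

Lemma hat_itv (R : realType) (h t : R) : 0 < h -> 0 <= hat h t <= h^-1.
Proof.
move=> h0; have hV : 0 <= h^-1 by rewrite invr_ge0 ltW.
have [t0|t0] := lerP t 0; first by rewrite hat_le0// lexx.
have [ht|th] := lerP (2 * h) t; first by rewrite hat_ge// lexx.
have h2 : 0 < h ^+ 2 by rewrite exprn_gt0.
rewrite /hat (pos_part_ge (ltW t0)) (@pos_part_le _ (t - 2 * h)); last by lra.
rewrite mulrC ler_pdivlMr// ler_pdivrMr// mul0r.
rewrite (_ : h^-1 * h ^+ 2 = h); last by field; rewrite gt_eqF.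
have [th'|ht'] := lerP t h.
  by rewrite (@pos_part_le _ (t - h)); [apply/andP; split; nra | lra].
by rewrite (@pos_part_ge _ (t - h)); [apply/andP; split; nra | lra].
Qed.

Lemma continuous_hat (R : realType) (h : R) : continuous (hat h).
Proof.
have c0 (c : R) : continuous (fun t : R => pos_part (t - c)).
  move=> t; apply: (@continuous_comp _ _ _ (fun t => t - c) (@pos_part R)).
    by apply: cvgB; [exact: cvg_id | exact: cvg_cst].
  exact: continuous_pos_part.
move=> t; apply: cvgM; first exact: cvg_cst.
apply: cvgD; last exact: c0.
apply: cvgB; first exact: continuous_pos_part.
by apply: cvgM; [exact: cvg_cst | exact: c0].
Qed.

(** A ramp up on [[a + h, a + 3 * h]] and a ramp down on [[b - 3 * h, b - h]]. The margins of width
    [h] keep the support compact in []a, b[]; a sum minus 1, rather than a product, keeps the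
    derivative a difference of hats. *)
Definition trapezoid (R : realType) (a b h x : R) : R :=
  ramp h (x - (a + h)) + ramp h (b - h - x) - 1.

Lemma is_derive_trapezoid (R : realType) (a b h x : R) :
  0 < h ->
  is_derive x (1 : R) (trapezoid a b h)
    (hat h (x - (a + h)) - hat h (b - h - x)).
Proof.
move=> h0.
have d1 := @is_derive_sqr_pos_partDr R (a + h) x.
have d2 := @is_derive_sqr_pos_partDr R (a + h + h) x.
have d3 := @is_derive_sqr_pos_partDr R (a + h + 2 * h) x.
have d4 := @is_derive_sqr_pos_partBr R (b - h) x.
have d5 := @is_derive_sqr_pos_partBr R (b - h - h) x.
have d6 := @is_derive_sqr_pos_partBr R (b - h - 2 * h) x.
(* As a linear combination of the six squares differentiated in [d1] to [d6], the function is
   handled by derivative inference. *)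
have -> : trapezoid a b h =
  fun y => (2 * h ^+ 2)^-1 *
    (pos_part (y - (a + h)) ^+ 2 - 2 * pos_part (y - (a + h + h)) ^+ 2
     + pos_part (y - (a + h + 2 * h)) ^+ 2
     + pos_part (b - h - y) ^+ 2 - 2 * pos_part (b - h - h - y) ^+ 2
     + pos_part (b - h - 2 * h - y) ^+ 2) - 1.
  apply/funext => y; rewrite /trapezoid /ramp.
  rewrite (_ : y - (a + h) - h = y - (a + h + h)); last by ring.
  rewrite (_ : y - (a + h) - 2 * h = y - (a + h + 2 * h)); last by ring.
  rewrite (_ : b - h - y - h = b - h - h - y); last by ring.
  rewrite (_ : b - h - y - 2 * h = b - h - 2 * h - y); last by ring.
  ring.
rewrite /hat.
rewrite (_ : x - (a + h) - h = x - (a + h + h)); last by ring.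
rewrite (_ : x - (a + h) - 2 * h = x - (a + h + 2 * h)); last by ring.
rewrite (_ : b - h - x - h = b - h - h - x); last by ring.
rewrite (_ : b - h - x - 2 * h = b - h - 2 * h - x); last by ring.
apply: is_derive_eq; rewrite /GRing.scale/=; field.
by rewrite gt_eqF.
Qed.

Lemma derive1_trapezoid (R : realType) (a b h : R) : 0 < h ->
  derive1 (trapezoid a b h) =
  fun x => hat h (x - (a + h)) - hat h (b - h - x).
Proof.
move=> h0; apply/funext => x; rewrite derive1E.
by have d := is_derive_trapezoid a b x h0; rewrite derive_val.
Qed.

Lemma test_fun_trapezoid (R : realType) (a b h : R) :
  0 < h -> 6 * h <= b - a -> test_fun `]a, b[ (trapezoid a b h).
Proof.
move=> h0 hab.
have supp : closure [set x | trapezoid a b h x != 0] `<=` `[a + h, b - h].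
  rewrite [X in _ `<=` X](closure_id _).1; last exact: itv_closed.
  (* Outside [[a + h, b - h]] one ramp is 0, and [6 * h <= b - a] makes the other equal to 1. *)
  apply: closure_subset => x /=; apply: contraNT.
  rewrite in_itv/= negb_and -!ltNge /trapezoid => /orP[xa | bx].
    by rewrite ramp_le0 ?ramp_ge; [apply/eqP; ring | lra..].
  by rewrite (@ramp_le0 _ h (b - h - x)) ?ramp_ge; [apply/eqP; ring | lra..].
split.
- by move=> x; have d := is_derive_trapezoid a b x h0; exact: ex_derive.
- rewrite derive1_trapezoid// => x; apply: cvgB.
    apply: (@continuous_comp _ _ _ (fun x => x - (a + h)) (hat h)).
      by apply: cvgB; [exact: cvg_id | exact: cvg_cst].
    exact: continuous_hat.
  apply: (@continuous_comp _ _ _ (fun x => b - h - x) (hat h)).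
    by apply: cvgB; [exact: cvg_cst | exact: cvg_id].
  exact: continuous_hat.
- by apply: subclosed_compact supp; [exact: closed_closure | exact: segment_compact].
- apply: (subset_trans supp) => x /=; rewrite !in_itv/=; lra.
Qed.

Lemma trapezoid_eq1 (R : realType) (a b h x : R) :
  0 < h -> a + 3 * h <= x <= b - 3 * h -> trapezoid a b h x = 1.
Proof. by move=> h0 hx; rewrite /trapezoid !ramp_ge; [ring | lra..]. Qed.

(** Since [a + 3 * h <= b - 3 * h], at each point one of the two ramps equals 1, and the trapezoid
    reduces to the other. *)
Lemma trapezoid_itv (R : realType) (a b h x : R) :
  0 < h -> 6 * h <= b - a -> 0 <= trapezoid a b h x <= 1.
Proof.
move=> h0 hab; rewrite /trapezoid.
have /andP[r0 r1] := ramp_itv (x - (a + h)) h0.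
have /andP[s0 s1] := ramp_itv (b - h - x) h0.
have [xm|xm] := lerP x (b - 3 * h); last rewrite (@ramp_ge _ h (x - _)) //; try lra.
by rewrite (@ramp_ge _ h (b - h - x)) //; lra.
Qed.

Lemma derive1_trapezoid_le (R : realType) (a b h x : R) :
  0 < h -> `|derive1 (trapezoid a b h) x| <= h^-1.
Proof.
move=> h0; rewrite derive1_trapezoid// ler_norml.
have := hat_itv (x - (a + h)) h0; have := hat_itv (b - h - x) h0.
by lra.
Qed.

Lemma derive1_trapezoid_eq0 (R : realType) (a b h x : R) :
  0 < h -> a + 3 * h <= x <= b - 3 * h -> derive1 (trapezoid a b h) x = 0.
Proof.
by move=> h0 hx; rewrite derive1_trapezoid// !hat_ge ?subrr//; lra.
Qed.

(** * Mean of a weak derivative *)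

(** Serves to subtract from a displacement the affine interpolant of its boundary values. *)
Lemma weak_derivative_affine (R : realType) (a b p q : R) :
  a <= b -> weak_derivative `]a, b[ (fun x => p + q * x) (cst q).
Proof.
move=> ab phi tphi; have [dphi cphi' _ _] := tphi.
rewrite integral_affine_derive1// (test_fun_out tphi (x := a)); last first.
  by rewrite /= in_itv/= ltxx.
rewrite (test_fun_out tphi (x := b)); last by rewrite /= in_itv/= ltxx andbF.
by rewrite !mulr0 subrr add0e.
Qed.

(* [w] need only be small where the slopes of the trapezoid live, that is on two
   layers of width [3 h]; the slopes being at most [1 / h], [h] cancels. *)
Lemma integral_trapezoid_le (R : realType) (a b h eta : R) (w : R -> R) :
  0 < h -> 6 * h <= b - a -> 0 <= eta ->
  measurable_fun `]a, b[ w ->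
  {ae mu, forall x, x \in `]a, b[ -> x < a + 3 * h \/ b - 3 * h < x ->
    `|w x| <= eta} ->
  (`|\int[mu]_(x in `]a, b[) (w x * derive1 (trapezoid a b h) x)%:E|
    <= (6 * eta)%:E)%E.
Proof.
move=> h0 hab eta0 mw wle.
(* [K] bounds the integrand on the two boundary layers; its majorant [B] has integral
   [2 * (3 * h) * K = 6 * eta]. *)
pose K := eta / h.
have K0 : 0 <= K by rewrite divr_ge0// ltW.
pose B := piecewise (a + 3 * h) (cst K) (piecewise (b - 3 * h) (cst 0) (cst K)).
have mB' : measurable_fun setT (piecewise (b - 3 * h) (cst 0) (cst K)).
  exact: measurable_piecewise.
have mB : measurable_fun setT B by exact: measurable_piecewise.
have tphi := test_fun_trapezoid h0 hab.
have [_ cphi' _ _] := tphi.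
have mf : measurable_fun `]a, b[ (fun x => w x * derive1 (trapezoid a b h) x).
  apply: measurable_funM => //; apply: measurable_funTS.
  exact: continuous_measurable_fun.
apply: le_trans (le_abse_integral mu _ _) _ => //; first exact/measurable_EFinP.
have -> : (6 * eta)%:E = (\int[mu]_(x in `]a, b[) (B x)%:E)%E.
  rewrite integral_piecewise//; last by apply/andP; split; lra.
  rewrite integral_piecewise//; last by apply/andP; split; lra.
  rewrite !integral_cst_itvoo; [ | lra..].
  rewrite -!EFinD; congr EFin; rewrite /K; field.
  by rewrite gt_eqF.
apply: ae_ge0_le_integral => //.
- by apply: measurableT_comp => //; exact/measurable_EFinP.
- by move=> x _; rewrite lee_fin /B /piecewise; do 2?case: ifP.
- by apply/measurable_EFinP; exact: measurable_funTS.
apply: (@filterS _ _ (ae_filter_ringOfSetsType mu) _ _ _ wle) => x wx xab.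
rewrite abse_EFin lee_fin normrM.
have {}wx := wx xab.
have d1 := derive1_trapezoid_le a b x h0.
have KE : K = eta * h^-1 by [].
rewrite /B /piecewise; case: ifPn => xa; first by rewrite KE ler_pM// wx//; left.
case: ifPn => xb; last first.
  (* [B] counts the point [b - 3 * h] in the layer, whereas the bound on [w] holds strictly beyond
     it; there the slope is 0. *)
  have [xb'|xb'] := eqVneq x (b - 3 * h).
    rewrite derive1_trapezoid_eq0 ?normr0 ?mulr0//; lra.
  rewrite KE ler_pM// wx//; right; lra.
by rewrite derive1_trapezoid_eq0 ?normr0 ?mulr0//; lra.
Qed.

(** After subtracting the affine interpolant, [w] is small near the endpoints. Integrals of its weak
    derivative [z] against the trapezoids converge to the integral of [z], and by duality they tend
    to 0. *)
Lemma integral_weak_derivative (R : realType) (a b ua ub : R) (u v : R -> R) :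
  a < b -> H1_with_derivative `]a, b[ u v -> has_boundary_values a b u ua ub ->
  (\int[mu]_(x in `]a, b[) (v x)%:E = (ub - ua)%:E)%E.
Proof.
move=> ab [L2u L2v wuv] [U [cU uU Ua Ub]].
have iu := L2_integrable L2u; have iv := L2_integrable L2v.
(* [p + q * x] takes the values [ua] at [a] and [ub] at [b]. *)
pose q := (ub - ua) / (b - a); pose p := ua - q * a.
have cst_cont : continuous (cst q : R -> R) by move=> x; exact: cvg_cst.
have iq := continuous_integrable_itvoo a b cst_cont.
have ipq := continuous_integrable_itvoo a b (@continuous_affine _ p q).
pose w x := u x - (p + q * x); pose z x := v x - q.
have iw : mu.-integrable `]a, b[ (EFin \o w).
  by apply: eq_integrable (integrableB _ iu ipq).
have iz : mu.-integrable `]a, b[ (EFin \o z).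
  by apply: eq_integrable (integrableB _ iv iq).
have wwz : weak_derivative `]a, b[ w z.
  move=> phi tphi; have cphi := test_fun_continuous tphi.
  have [dphi cphi' _ _] := tphi.
  have /= Iu := integrable_continuousM iu cphi'.
  have /= Iv := integrable_continuousM iv cphi.
  have /= Ipq := integrable_continuousM ipq cphi'.
  have /= Iq := integrable_continuousM iq cphi.
  under eq_integral do rewrite mulrBl EFinB.
  under [in RHS]eq_integral do rewrite mulrBl EFinB.
  rewrite !integralB_EFin// wuv// (weak_derivative_affine p q (ltW ab) tphi).
  rewrite -(fineK (integrable_fin_num _ Iv))// -(fineK (integrable_fin_num _ Iq))//.
  by rewrite -!EFinN -!EFinD opprB opprK addrC.
(* Widths tending to 0, starting at the largest one allowed by [6 * h <= b - a]. *)
pose h (n : nat) : R := (b - a) / 6 * n.+1%:R^-1.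
have h0 n : 0 < h n by rewrite mulr_gt0// ?invr_gt0// divr_gt0// subr_gt0.
have h6 n : 6 * h n <= b - a.
  rewrite /h mulrA (_ : 6 * ((b - a) / 6) = b - a); last by field.
  by rewrite ler_piMr ?subr_ge0 ?(ltW ab)// invf_le1// ler1n.
have h_small (e : R) : 0 < e -> \forall n \near \oo, 3 * h n < e.
  move=> e0.
  have ep : 0 < 2 * e / (b - a) by rewrite divr_gt0 ?mulr_gt0 ?subr_gt0.
  have := near_infty_natSinv_lt (PosNum ep); apply: filterS => n /=.
  rewrite ltr_pdivlMr ?subr_gt0// /h; move: (n.+1%:R^-1) => r ?; lra.
pose I n := (\int[mu]_(x in `]a, b[) (z x * trapezoid a b (h n) x)%:E)%E.
have Icvg : I n @[n --> \oo] --> (\int[mu]_(x in `]a, b[) (z x)%:E)%E.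
  have ctr n : continuous (trapezoid a b (h n)).
    exact: test_fun_continuous (test_fun_trapezoid (h0 n) (h6 n)).
  have [ | | | | | _ _ //] := @dominated_convergence _ _ _ mu `]a, b[
    (measurable_itv _) (fun n x => (z x * trapezoid a b (h n) x)%:E)
    (EFin \o z) (abse \o (EFin \o z)).
  - move=> n; have := integrable_continuousM iz (ctr n).
    exact: measurable_int.
  - exact: measurable_int iz.
  - apply: aeW => x /=; rewrite in_itv/= => /andP[ax xb].
    (* Each [x] ends up on the plateau, so the sequence is eventually constant at [x]. *)
    apply: cvg_near_cst.
    have := h_small _ (_ : 0 < Num.min (x - a) (b - x)).
    rewrite lt_min !subr_gt0 ax xb => /(_ isT); apply: filterS => n.
    rewrite lt_min => /andP[? ?].
    by rewrite trapezoid_eq1 ?mulr1//; lra.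
  - exact: integrable_abse.
  - apply: aeW => x n _; rewrite /= lee_fin normrM ler_piMr//.
    have /andP[t0 t1] := trapezoid_itv x (h0 n) (h6 n).
    by rewrite ger0_norm.
have Ismall (e : R) : 0 < e -> \forall n \near \oo, (`|I n| <= (6 * e)%:E)%E.
  move=> e0.
  (* The continuous representative of [w], with limit 0 at both endpoints; once [3 * h n] is below
     [da] and [db], it is at most [e] in absolute value on both layers. *)
  pose U0 x := U x - (p + q * x).
  have caff := @continuous_affine _ p q.
  have [_ cUa cUb] := (continuous_within_itvP U ab).1 cU.
  have U0a : U0 x @[x --> a^'+] --> (0 : R).
    rewrite (_ : 0 = U a - (p + q * a)); last by rewrite Ua /p; ring.
    by apply: cvgB => //; exact/cvg_at_right_filter/caff.
  have U0b : U0 x @[x --> b^'-] --> (0 : R).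
    rewrite (_ : 0 = U b - (p + q * b)); last first.
      by rewrite Ub /p /q; field; lra.
    by apply: cvgB => //; exact/cvg_at_left_filter/caff.
  have /cvgrPdist_le/(_ _ e0)[da da0 Ha] := U0a.
  have /cvgrPdist_le/(_ _ e0)[db db0 Hb] := U0b.
  have := h_small _ (_ : 0 < Num.min da db).
  rewrite lt_min da0 db0 => /(_ isT); apply: filterS => n.
  rewrite lt_min => /andP[hda hdb].
  have tphi := test_fun_trapezoid (h0 n) (h6 n).
  (* The weak formulation replaces [z] times the trapezoid by [w] times its slope, up to sign. *)
  have := wwz _ tphi; rewrite -/(I n) => /(congr1 (fun y => `|y|%E)).
  rewrite abseN => <-.
  apply: integral_trapezoid_le (ltW e0) _ _ => //.
    by apply/measurable_EFinP; exact: measurable_int iw.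
  apply: (@filterS _ _ (ae_filter_ringOfSetsType mu) _ _ _ uU) => x uUx xab.
  rewrite /w (uUx xab) -/(U0 x).
  move: xab; rewrite in_itv/= => /andP[ax xb] [xa|xb'].
    have := Ha x; rewrite /= sub0r normrN; apply => //.
    by rewrite distrC gtr0_norm ?subr_gt0//; lra.
  have := Hb x; rewrite /= sub0r normrN; apply => //.
  by rewrite gtr0_norm ?subr_gt0//; lra.
have If : (\int[mu]_(x in `]a, b[) (z x)%:E)%E \is a fin_num.
  by apply: integrable_fin_num => //.
have I0 : (\int[mu]_(x in `]a, b[) (z x)%:E)%E = 0%E.
  apply: cvg_unique Icvg _ => //.
  apply/fine_cvgP; split.
    apply: filterS (Ismall 1 ltr01) => n.
    by case: (I n).
  apply/cvgrPdist_le => e e0.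
  have e6 : 0 < e / 6 by rewrite divr_gt0.
  apply: filterS (Ismall _ e6) => n /=.
  rewrite sub0r normrN mulrC divfK//.
  by case: (I n) => //= r; rewrite lee_fin.
have intq : (\int[mu]_(x in `]a, b[) (cst q x)%:E = (ub - ua)%:E)%E.
  by rewrite integral_cst_itvoo ?(ltW ab)// /q divfK// subr_eq0 gt_eqF.
rewrite -intq; move: I0.
under eq_integral do rewrite EFinB.
rewrite integralB_EFin// intq.
case: (\int[mu]_(x in _) (v x)%:E)%E => [r | |] //.
by rewrite -EFinB => -[] /eqP; rewrite subr_eq0 => /eqP ->.
Qed.

(** * Lower bound for the energy of every competitor *)

Lemma average_Rintegral (R : realType) (a b : R) (g : R -> R) :
  a < b -> mu.-integrable `]a, b[ (EFin \o g) ->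
  average `]a, b[ g = ((b - a)^-1 * \int[mu]_(x in `]a, b[) g x)%:E.
Proof.
move=> ab ig; rewrite /average lebesgue_measure_itvoo ?(ltW ab)//.
rewrite inver subr_eq0 gt_eqF// EFinM /Rintegral fineK//.
exact: integrable_fin_num ig.
Qed.

(** The gap between the two sides is [2^-1 * alpha * (x - e) ^+ 2]. *)
Lemma elastic_energy_tangent (R : realType) (alpha epsT w e x : R) :
  0 <= alpha ->
  elastic_energy alpha epsT w e + alpha * (e - epsT) * (x - e)
    <= elastic_energy alpha epsT w x.
Proof.
move=> alpha0; rewrite /elastic_energy.
by have := mulr_ge0 alpha0 (sqr_ge0 (x - e)); lra.
Qed.

Lemma integrable_elastic_energy (R : realType) (a b alpha epsT w : R)
    (v : R -> R) :
  L2 `]a, b[ v ->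
  mu.-integrable `]a, b[ (EFin \o (elastic_energy alpha epsT w \o v)).
Proof.
move=> L2v; have iv := L2_integrable L2v; have [_ iv2] := L2v.
have ic : mu.-integrable `]a, b[ (EFin \o cst (2^-1 * alpha * epsT ^+ 2 + w)).
  by apply: continuous_integrable_itvoo => x; exact: cvg_cst.
have mab : measurable (`]a, b[ : set (measurableTypeR R)) by [].
have := integrableD mab (integrableZl mab (2^-1 * alpha) iv2)
  (integrableD mab (integrableZl mab (- alpha * epsT) iv) ic).
apply: eq_integrable => // x _ /=.
by rewrite -!EFinM -!EFinD /elastic_energy; congr EFin; field.
Qed.

(* [W1 e1 - sigma e1] and [W2 e2 - sigma e2] are the intercepts of tangents with
   the common slope [sigma], so that the lower bound is affine in [v]. *)
Lemma average_energy_ge (R : realType) (a b alpha1 alpha2 eps1T eps2T w1 w2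
    d eps e1 e2 sigma : R) (dt u v : R -> R) :
  a < b -> 0 <= alpha1 -> 0 <= alpha2 ->
  alpha1 * (e1 - eps1T) = sigma -> alpha2 * (e2 - eps2T) = sigma ->
  d * e1 + (1 - d) * e2 = eps ->
  BV01 `]a, b[ dt -> average `]a, b[ dt = d%:E ->
  H1_with_derivative `]a, b[ u v ->
  has_boundary_values a b u (eps * a) (eps * b) ->
  ((d * elastic_energy alpha1 eps1T w1 e1
    + (1 - d) * elastic_energy alpha2 eps2T w2 e2)%:E
   <= average `]a, b[
        (fun x => dt x * elastic_energy alpha1 eps1T w1 (v x)
                  + (1 - dt x) * elastic_energy alpha2 eps2T w2 (v x))%R)%E.
Proof.
move=> ab alpha10 alpha20 sigma1 sigma2 epsE [[idt _] dt01] dtd uv ubd.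
set W1 := elastic_energy alpha1 eps1T w1.
set W2 := elastic_energy alpha2 eps2T w2.
have [_ L2v _] := uv; have iv := L2_integrable L2v.
have mab : measurable (`]a, b[ : set (measurableTypeR R)) by [].
have mdt : measurable_fun `]a, b[ dt.
  by apply/measurable_EFinP; exact: measurable_int idt.
have dt_itv x : `]a, b[%classic x -> 0 <= dt x <= 1.
  by move=> /dt01[] ->; rewrite lexx ler01.
have dtb : [bounded dt x | x in `]a, b[%classic].
  exists 1; split=> // M M1 x /dt_itv /andP[x0 x1] /=.
  by rewrite ger0_norm//; lra.
have dtb' : [bounded 1 - dt x | x in `]a, b[%classic].
  exists 1; split=> // M M1 x /dt_itv /andP[x0 x1] /=.
  by rewrite ger0_norm; lra.
have iE1 := integrableMr mab mdt dtb
  (integrable_elastic_energy alpha1 eps1T w1 L2v).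
have mdt' : measurable_fun `]a, b[ (fun x => 1 - dt x).
  by apply: measurable_funB.
have iE2 := integrableMr mab mdt' dtb'
  (integrable_elastic_energy alpha2 eps2T w2 L2v).
have iE : mu.-integrable `]a, b[
    (EFin \o (fun x => dt x * W1 (v x) + (1 - dt x) * W2 (v x))).
  by apply: eq_integrable (integrableD mab iE1 iE2).
rewrite average_Rintegral// lee_fin.
pose k1 := W1 e1 - sigma * e1; pose k2 := W2 e2 - sigma * e2.
have ik2 : mu.-integrable `]a, b[ (EFin \o (cst k2)).
  by apply: continuous_integrable_itvoo => x; exact: cvg_cst.
have iv' : mu.-integrable `]a, b[ (EFin \o (fun x => sigma * v x)).
  by apply: eq_integrable (integrableZl mab sigma iv).
have idt' : mu.-integrable `]a, b[ (EFin \o (fun x => (k1 - k2) * dt x)).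
  by apply: eq_integrable (integrableZl mab (k1 - k2) idt).
have ivk : mu.-integrable `]a, b[ (EFin \o (fun x => sigma * v x + cst k2 x)).
  by apply: eq_integrable (integrableD mab iv' ik2).
(* The mixture of the two tangents with weights [dt x] and [1 - dt x]. The common slope removes the
   product of [dt] and [v], so the integral depends only on their averages. *)
have iL : mu.-integrable `]a, b[
    (EFin \o (fun x => (k1 - k2) * dt x + (sigma * v x + cst k2 x))).
  by apply: eq_integrable (integrableD mab idt' ivk).
have intv : \int[mu]_(x in `]a, b[) v x = eps * (b - a).
  by rewrite /Rintegral (integral_weak_derivative ab uv ubd)/= mulrBr.
have intdt : \int[mu]_(x in `]a, b[) dt x = d * (b - a).
  move: dtd; rewrite average_Rintegral// => -[] <-.
  by rewrite mulrC mulrA divff ?mul1r// subr_eq0 gt_eqF.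
have intk2 : \int[mu]_(x in `]a, b[) cst k2 x = k2 * (b - a).
  by rewrite /Rintegral integral_cst_itvoo ?(ltW ab).
have : \int[mu]_(x in `]a, b[) ((k1 - k2) * dt x + (sigma * v x + cst k2 x))
    <= \int[mu]_(x in `]a, b[) (dt x * W1 (v x) + (1 - dt x) * W2 (v x)).
  apply: le_Rintegral => // x /dt_itv /andP[dt0 dt1].
  have t1 := @elastic_energy_tangent R alpha1 eps1T w1 e1 (v x) alpha10.
  have t2 := @elastic_energy_tangent R alpha2 eps2T w2 e2 (v x) alpha20.
  rewrite sigma1 in t1; rewrite sigma2 in t2.
  have dt1' : 0 <= 1 - dt x by lra.
  have := ler_wpM2l dt0 t1; have := ler_wpM2l dt1' t2.
  by rewrite /k1 /k2 -/W1 -/W2 /=; lra.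
rewrite RintegralD// RintegralD// !RintegralZl//.
rewrite intv intdt intk2.
rewrite ler_pdivlMl ?subr_gt0//; apply: le_trans.
by rewrite -epsE /k1 /k2 le_eqVlt; apply/orP; left; apply/eqP; ring.
Qed.

(** * Closed form of the relaxed energy and its derivatives *)

Section homogenized.
Context {R : realType}.
Variables (alpha1 alpha2 eps1T eps2T w1 w2 : R).
Hypotheses (alpha1_gt0 : 0 < alpha1) (alpha2_gt0 : 0 < alpha2).
Local Notation W1 := (elastic_energy alpha1 eps1T w1).
Local Notation W2 := (elastic_energy alpha2 eps2T w2).
Local Notation e1 := (eps1_star alpha1 alpha2 eps1T eps2T).
Local Notation e2 := (eps2_star alpha1 alpha2 eps1T eps2T).

Lemma modulus_gt0 (d : R) : 0 <= d <= 1 -> 0 < (1 - d) * alpha1 + d * alpha2.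
Proof.
move=> /andP[d0 d1]; have d10 : 0 <= 1 - d by rewrite subr_ge0.
have m1 := mulr_ge0 d10 (ltW alpha1_gt0); have [dn|dp] := lerP d 0.
  have -> : d = 0 by apply/le_anti; rewrite dn.
  by rewrite subr0 mul1r mul0r addr0.
by rewrite ltr_wpDl// mulr_gt0.
Qed.

(** The equal-stress (Reuss) energy: the effective modulus is the weighted harmonic mean of the
    moduli, the effective eigenstrain the weighted arithmetic mean. Its dependence on [d] and [eps]
    is explicit, ready for differentiation. *)
Definition homogenized_energy (d eps : R) : R :=
  2^-1 * (alpha1 * alpha2) * (eps - d * eps1T - (1 - d) * eps2T) ^+ 2 /
    ((1 - d) * alpha1 + d * alpha2) + d * w1 + (1 - d) * w2.

Lemma homogenized_energyE (d eps : R) : 0 <= d <= 1 ->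
  d * W1 (e1 d eps) + (1 - d) * W2 (e2 d eps) = homogenized_energy d eps.
Proof.
move=> /modulus_gt0 D0.
rewrite /homogenized_energy /elastic_energy /eps1_star /eps2_star; field.
by rewrite gt_eqF.
Qed.

Lemma What_homogenized (a b d eps : R) : a < b -> 0 <= d <= 1 ->
  What a b W1 W2 d eps = (d * W1 (e1 d eps) + (1 - d) * W2 (e2 d eps))%:E.
Proof.
move=> ab d01; have /andP[d0 d1] := d01; have D0 := modulus_gt0 d01.
have Dn : (1 - d) * alpha1 + d * alpha2 != 0 by rewrite gt_eqF.
have epsE : d * e1 d eps + (1 - d) * e2 d eps = eps.
  by rewrite /eps1_star /eps2_star; field.
apply/eqP; rewrite eq_le; apply/andP; split; last first.
  apply/ereal_infP => _ [dt [dtBV dtd] <-].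
  apply/ereal_infP => _ [u [v [uv ubd ->]]].
  apply: (average_energy_ge _ _ ab _ _ _ _ epsE dtBV dtd uv ubd) => //.
  - exact: ltW.
  - exact: ltW.
  (* The stresses in the two phases agree. *)
  - by rewrite /eps1_star /eps2_star; field.
(* The interface that gives phase 1 the volume fraction [d]. *)
pose c := a + d * (b - a).
have acb : a <= c <= b by apply/andP; split; rewrite /c; nra.
pose dt := piecewise c (cst 1) (cst 0) : R -> R.
pose v := piecewise c (cst (e1 d eps)) (cst (e2 d eps)).
(* The intercepts are fixed by the boundary values at [a] and [b]; continuity at [c] then says that
   the average strain is [eps], which is [epsE]. *)
pose p1 := eps * a - e1 d eps * a; pose p2 := eps * b - e2 d eps * b.
pose u := piecewise c (fun x => p1 + e1 d eps * x) (fun x => p2 + e2 d eps * x).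
have pc : p1 + e1 d eps * c = p2 + e2 d eps * c.
  rewrite /p1 /p2 /c; move: (e1 d eps) (e2 d eps) epsE => x y <-; ring.
apply: ge_ereal_inf; exists (min_energy a b W1 W2 dt eps).
  exists dt => //; split; first exact: BV01_piecewise.
  rewrite average_piecewise_cst// /c; congr EFin; field.
  by rewrite subr_eq0 gt_eqF.
apply: ge_ereal_inf.
exists (average `]a, b[ (piecewise c (cst (W1 (e1 d eps))) (cst (W2 (e2 d eps))))).
  exists u, v; split.
  - split; last exact: weak_derivative_piecewise_affine.
      by apply: L2_piecewise; exact: continuous_affine.
    by apply: L2_piecewise => x; exact: cvg_cst.
  - have := has_boundary_values_piecewise_affine acb pc.
    by rewrite /p1 /p2 !subrK.
  - congr average; apply/funext => x; rewrite /dt /v /piecewise.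
    by case: ifP => _ /=; rewrite ?subrr ?subr0 ?mul1r ?mul0r ?addr0 ?add0r.
rewrite average_piecewise_cst// lee_fin /c le_eqVlt.
apply/orP; left; apply/eqP; field.
by rewrite subr_eq0 gt_eqF.
Qed.

Lemma is_derive_homogenized_energy (d eps : R) : 0 <= d <= 1 ->
  is_derive eps (1 : R) (homogenized_energy d)
    (alpha1 * alpha2 * (d * (eps - eps1T) + (1 - d) * (eps - eps2T)) /
     ((1 - d) * alpha1 + d * alpha2)).
Proof.
move=> /modulus_gt0 D0; rewrite /homogenized_energy.
apply: is_derive_eq; rewrite /GRing.scale/=; field.
by rewrite gt_eqF.
Qed.

(** On [[0, 1]] the difference quotient coincides with a function of [t] that is continuous at [d];
    this treats interior points and the endpoints at once. *)
Lemma is_derive_within_homogenized_energy (d eps : R) : 0 <= d <= 1 ->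
  is_derive_within `[0, 1] (homogenized_energy^~ eps) d
    (W1 (e1 d eps) - W2 (e2 d eps) +
     alpha1 * alpha2 / ((1 - d) * alpha1 + d * alpha2) ^+ 2 *
     ((alpha1 - alpha2) * eps ^+ 2
      + d * alpha1 * eps1T ^+ 2 - (1 - d) * alpha2 * eps2T ^+ 2
      + (alpha2 * eps2T - alpha1 * eps1T
         + (alpha2 - alpha1) * (d * eps1T + (1 - d) * eps2T)) * eps
      + ((1 - d) * alpha1 - d * alpha2) * eps1T * eps2T)).
Proof.
move=> d01; have D0 := modulus_gt0 d01.
pose D t := (1 - t) * alpha1 + t * alpha2.
(* At [t] the strain mismatch is [s + s' * (t - d)] and the denominator is
   [D d + (alpha2 - alpha1) * (t - d)], so [t - d] factors out of the difference. *)
pose s := eps - d * eps1T - (1 - d) * eps2T; pose s' := eps2T - eps1T.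
(* difference quotient of [homogenized_energy] after cancelling [t - d] *)
pose H t := 2^-1 * (alpha1 * alpha2) *
  (2 * s * s' * D d + s' ^+ 2 * D d * (t - d) - s ^+ 2 * (alpha2 - alpha1)) *
  (D d * D t)^-1 + (w1 - w2).
have cD : continuous D.
  move=> t; apply: cvgD; apply: cvgM; do ?exact: cvg_cst; last exact: cvg_id.
  by apply: cvgB; [exact: cvg_cst | exact: cvg_id].
rewrite /is_derive_within.
rewrite [X in _ --> X](_ : _ = H d); last first.
  rewrite /H /D /s /s' /elastic_energy /eps1_star /eps2_star; field.
  by rewrite gt_eqF.
apply: (@cvg_trans _ (H t @[t --> within `[0, 1] d^'])).
  apply: near_eq_cvg; apply: filterS (nbhs_dnbhs_neq d) => t td.
  rewrite /= in_itv/= => /modulus_gt0 Dt0.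
  rewrite /H /D /s /s' /homogenized_energy; field.
  by rewrite subr_eq0 td !gt_eqF.
(* Both restrictions, to [[0, 1]] and to [t != d], are dropped: [H] converges along the full
   neighbourhood filter. *)
do 2!apply: cvg_within_filter.
apply: cvgD; last exact: cvg_cst.
apply: cvgM.
  apply: cvgM; first exact: cvg_cst.
  apply: cvgB; last exact: cvg_cst.
  apply: cvgD; first exact: cvg_cst.
  by apply: cvgM; [exact: cvg_cst | apply: cvgB; [exact: cvg_id | exact: cvg_cst]].
apply: cvgV; first by rewrite mulf_neq0 ?gt_eqF.
by apply: cvgM; [exact: cvg_cst | exact: cD].
Qed.

End homogenized.

(** The closed form of [What] is established for fractions in [[0, 1]], so the derivative in [d] is
    transferred through an equality on that set; [A x] covers the value at the base point. *)
Lemma eq_is_derive_within (R : realType) (A : set R) (f g : R -> R) (x l : R) :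
  A x -> {in A, f =1 g} -> is_derive_within A g x l -> is_derive_within A f x l.
Proof.
rewrite /is_derive_within => Ax fg; apply: cvg_trans; apply: fmap_within_eq => t At.
by rewrite (fg t At) (fg x (mem_set Ax)).
Qed.

Theorem theorem4 (R : realType) (a b : R) (hab : a < b)
    (alpha1 alpha2 eps1T eps2T w1 w2 : R)
    (halpha1 : 0 < alpha1) (halpha2 : 0 < alpha2)
    (hw1 : 0 <= w1) (hw2 : 0 <= w2)
    (d eps : R) (hd : 0 <= d <= 1) :
  let W1 := elastic_energy alpha1 eps1T w1 in
  let W2 := elastic_energy alpha2 eps2T w2 in
  let d1 := d in
  let d2 := 1 - d in
  let e1 := eps1_star alpha1 alpha2 eps1T eps2T d eps in
  let e2 := eps2_star alpha1 alpha2 eps1T eps2T d eps in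
  [/\ What a b W1 W2 d eps = (d * W1 e1 + (1 - d) * W2 e2)%:E,
      is_derive eps 1 (fun e : R => fine (What a b W1 W2 d e))
        (alpha1 * alpha2 * (d1 * (eps - eps1T) + d2 * (eps - eps2T)) /
         (d2 * alpha1 + d1 * alpha2)) &
      is_derive_within `[0, 1] (fun t : R => fine (What a b W1 W2 t eps)) d
        (W1 e1 - W2 e2 +
         alpha1 * alpha2 / (d2 * alpha1 + d1 * alpha2) ^+ 2 *
         ((alpha1 - alpha2) * eps ^+ 2
          + d1 * alpha1 * eps1T ^+ 2 - d2 * alpha2 * eps2T ^+ 2
          + (alpha2 * eps2T - alpha1 * eps1T
             + (alpha2 - alpha1) * (d1 * eps1T + d2 * eps2T)) * eps
          + (d2 * alpha1 - d1 * alpha2) * eps1T * eps2T))].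
Proof.
move=> W1 W2 d1 d2 e1 e2.
have WhatE t e : 0 <= t <= 1 -> fine (What a b W1 W2 t e) =
    homogenized_energy alpha1 alpha2 eps1T eps2T w1 w2 t e.
  by move=> t01; rewrite What_homogenized// homogenized_energyE.
split; first exact: What_homogenized.
  (* With [d] fixed in [[0, 1]] the closed form holds for every strain, so the functions of [e] are
     equal outright. *)
  rewrite (funext (fun e => WhatE d e hd)).
  exact: is_derive_homogenized_energy.
apply: (@eq_is_derive_within _ _ _
  (homogenized_energy alpha1 alpha2 eps1T eps2T w1 w2 ^~ eps)) => //.
  by move=> t; rewrite inE/= in_itv/=; exact: WhatE.
exact: is_derive_within_homogenized_energy.
Qed.
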